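(* Let $\sigma_f=0$ and $\alpha>0$ in the binary signal-plus-noise model with logit-regularized training loss described in the context. Then the minimizer of the training loss achieves perfect generalization accuracy if and only if $\lambda=d/N<1$.
   Context: Regime: the high-dimensional proportional limit $d,N\to\infty$ with the ratio $\lambda=d/N$ fixed, where $d$ is the input dimension and $N$ the number of training samples. Data model: a sample with label $y\in\{-1,+1\}$ is $\boldsymbol{x}=y\mu_f\boldsymbol{e}_1+\boldsymbol{\xi}\in\mathbb{R}^d$, where $\boldsymbol{e}_1$ is the signal direction (first coordinate axis), $\mu_f$ is the signal magnitude, and the noise $\boldsymbol{\xi}$ has independent entries $\xi_1\sim\mathcal{N}(0,\sigma_f^2)$ and $\xi_j\sim\mathcal{N}(0,\sigma_n^2)$ for $j>1$. Thus for $\sigma_f=0$ there is no noise along the signal direction. Training loss: for a linear classifier with weights $\boldsymbol{S}\in\mathbb{R}^d$ and no bias, $$\mathcal{L}(\boldsymbol{S})=\frac1N\sum_{i=1}^N\ell(y_i\boldsymbol{S}^\top\boldsymbol{x}_i),\qquad \ell(z)=(1-\alpha)\log(1+e^{-z})+\alpha f(z),$$ where $\alpha\in[0,1)$ is the regularization strength and $f$ is a convex and even function (the logit regularizer). For $\alpha>0$ the per-sample loss $\ell$ is strictly convex with a unique finite global minimum $z^*$. The generalization accuracy of $\boldsymbol{S}$ is the probability that a fresh sample $(\boldsymbol{x},y)$ from the same data model is classified correctly, i.e. $y\,\boldsymbol{S}^\top\boldsymbol{x}>0$; it is perfect if it equals $100\%$.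
   Formalization: Assumes z* ≠ 0 (automatic if f is differentiable at 0): for f(z)=2|z|, α=1/2, z*=0 and the minimizer S=0 has accuracy 0. ''The minimizer'' is perfect means one exists and all are perfect; at λ=1 the claim is about all sequences d, N with d/N→λ. *)

(* Defs.v *)
From HB Require Import structures.
From mathcomp Require Import all_boot all_order all_algebra.
From mathcomp Require Import all_classical all_reals all_analysis.
From mathcomp Require Import ring lra.

Set Implicit Arguments.
Unset Strict Implicit.
Unset Printing Implicit Defensive.

Import Order.TTheory GRing.Theory Num.Theory.
Import numFieldNormedType.Exports.

Local Open Scope classical_set_scope.
Local Open Scope ring_scope.

(* The centred normal law N(0, s^2). The case s = 0 has to be treated apart:
   the library's [normal_prob 0 0] is the uniform law on [0, 1]. *)
Definition centered_gaussian (R : realType) (s : R) : set R -> \bar R :=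
  fun B => if s == 0 then \d_(0 : R) B else normal_prob 0 s B.

Definition mutually_independent (disp : measure_display)
    (T : measurableType disp) (R : realType) (P : probability T R)
    (I : eqType) (Z : I -> {RV P >-> R}) : Prop :=
  forall (s : seq I) (B : I -> set R), uniq s ->
    (forall i, measurable (B i)) ->
    P (\bigcap_(i in [set` s]) (Z i @^-1` B i)) =
    (\prod_(i <- s) fine (P (Z i @^-1` B i)))%:E.

Section data_model.
Context (disp : measure_display) (T : measurableType disp) (R : realType).
Variable P : probability T R.
Variables (y : nat -> {RV P >-> R}) (xi : nat -> nat -> {RV P >-> R}).

Definition sample_variables (k : (nat + nat * nat)%type) : {RV P >-> R} :=
  match k with
  | inl i => y i
  | inr ij => xi ij.1 ij.2
  end.

(* Sample number i has label [y i] and noise coordinates [xi i j]; coordinates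
   are numbered from 0, so that j = 0 is the signal direction. One infinite
   array serves all sizes: dimension d uses the j < d, and a training set of
   size N uses the i < N. The law of each label is left free. *)
Record signal_plus_noise (sigma_f sigma_n : R) : Prop := SignalPlusNoise {
  label_sign : forall i w, y i w = 1 \/ y i w = -1 ;
  signal_noise_law : forall i (B : set R), measurable B ->
    distribution P (xi i 0%N) B = centered_gaussian sigma_f B ;
  orthogonal_noise_law : forall i j (B : set R), (0 < j)%N -> measurable B ->
    distribution P (xi i j) B = centered_gaussian sigma_n B ;
  sample_independence : mutually_independent sample_variables }.

Definition e1 (d : nat) : 'cV[R]_d := \col_j (val j == 0%N)%:R.

Definition input (mu : R) (d i : nat) (w : T) : 'cV[R]_d :=
  (y i w * mu) *: e1 d + \col_j xi i (val j) w.

Definition margin (mu : R) (d : nat) (S : 'cV[R]_d) (i : nat) (w : T) : R :=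
  y i w * (S^T *m input mu d i w) 0 0.

Definition sample_loss (alpha : R) (f : R -> R) (z : R) : R :=
  (1 - alpha) * ln (1 + expR (- z)) + alpha * f z.

Definition training_loss (alpha mu : R) (f : R -> R) (d N : nat) (w : T)
    (S : 'cV[R]_d) : R :=
  N%:R^-1 * \sum_(i < N) sample_loss alpha f (margin mu S i w).

Definition training_minimizer (alpha mu : R) (f : R -> R) (d N : nat) (w : T)
    (S : 'cV[R]_d) : Prop :=
  forall S' : 'cV[R]_d,
    training_loss alpha mu f N w S <= training_loss alpha mu f N w S'.

(* Sample number N is independent of the training samples 0, ..., N - 1, hence
   fresh. The weights S are a fixed vector here: for weights computed from the
   training set this is the probability conditional on that set. *)
Definition accuracy (mu : R) (d N : nat) (S : 'cV[R]_d) : \bar R :=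
  P [set w | 0 < margin mu S N w].

(* For d > N the training loss has an affine space of minimizers, hence the
   quantification over all of them. *)
Definition perfect_minimizer (alpha mu : R) (f : R -> R) (d N : nat)
    (w : T) : Prop :=
  (exists S : 'cV[R]_d, training_minimizer alpha mu f N w S) /\
  (forall S : 'cV[R]_d, training_minimizer alpha mu f N w S ->
     accuracy mu N S = 1%E).

End data_model.

Definition proportional_limit (R : realType) (lambda : R) (d N : nat -> nat)
    : Prop :=
  [/\ d n @[n --> \oo] --> \oo, N n @[n --> \oo] --> \oo &
      ((d n)%:R / (N n)%:R : R) @[n --> \oo] --> lambda].

(* The probability of E n tends to 1. The events A n spare us the measurability
   of the sets E n. *)
Definition with_high_probability (disp : measure_display)
    (T : measurableType disp) (R : realType) (P : probability T R)
    (E : nat -> set T) : Prop :=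
  exists A : nat -> set T,
    [/\ forall n, measurable (A n), forall n, A n `<=` E n &
        P (A n) @[n --> \oo] --> 1%E].

Definition unique_global_minimum (R : realType) (l : R -> R) (zstar : R)
    : Prop :=
  forall z, z != zstar -> l zstar < l z.

(* If f has a kink at 0 (say, f = C |.| with C large), the minimum z* of the
   sample loss can be 0, and then S = 0 minimizes the training loss. This
   cannot happen for an f that is differentiable at 0. *)
Lemma unique_global_minimum_neq0 (R : realType) (alpha zstar : R)
    (f : R -> R) :
  0 < alpha < 1 -> (forall z, f (- z) = f z) -> derivable f 0 1 ->
  unique_global_minimum (sample_loss alpha f) zstar -> zstar != 0.
Proof.
move=> /andP[alpha_gt0 alpha_lt1] f_even f_derivable zstar_min.
apply/eqP => zstar0; subst zstar; set l := sample_loss alpha f.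
have ln1D z : ln (1 + expR z) = z + ln (1 + expR (- z)) :> R.
  have -> : 1 + expR z = expR z * (1 + expR (- z)).
    by rewrite mulrDr mulr1 -expRD subrr expR0 addrC.
  by rewrite lnM ?posrE ?expR_gt0 ?addr_gt0 ?expR_gt0// expRK.
have lE z : l z = l (- z) - (1 - alpha) * z.
  by rewrite /l /sample_loss f_even opprK (ln1D z); ring.
have l_derivable : derivable l 0 1.
  have dexpN : is_derive (0 : R) (1 : R) (expR \o -%R) (expR (- 0) * - 1).
    exact: is_derive1_comp.
  have ln_arg : is_derive ((cst 1 + (expR \o -%R)) 0 : R) (1 : R) (@ln R)
      ((cst 1 + (expR \o -%R)) 0 : R)^-1.
    by apply: is_derive1_ln; rewrite /= addr_gt0 ?expR_gt0.
  have dln := is_derive1_comp ln_arg (is_deriveD (is_derive_cst _ _ _) dexpN).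
  have [dln' _] := dln.
  have dl := derivableD (derivableZ (k := 1 - alpha) dln')
                        (derivableZ (k := alpha) f_derivable).
  have lE' : l = (1 - alpha) \*: (@ln R \o (cst 1 + (expR \o -%R))) + alpha \*: f by [].
  by rewrite lE'.
have q_cvg : (fun h => h^-1 * (l h - l 0)) @ 0^' --> ('D_1 l 0 : R).
  rewrite (_ : (fun h => _) = fun h => h^-1 *: ((l \o shift 0) (h *: 1) - l 0)).
    exact: l_derivable.
  by apply/funext => h /=; rewrite addr0 [h *: 1]mulr1.
have q_right : (fun h => h^-1 * (l h - l 0)) @ 0^'+ --> ('D_1 l 0 : R).
  by apply: cvg_trans q_cvg; apply: cvg_app; apply: within_subset => h /= /gt_eqF/negbT.
have q_left : (fun h => h^-1 * (l h - l 0)) @ 0^'- --> ('D_1 l 0 : R).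
  by apply: cvg_trans q_cvg; apply: cvg_app; apply: within_subset => h /= /lt_eqF/negbT.
have l_min z : l 0 <= l z.
  by have [->//|/zstar_min/ltW] := eqVneq z 0.
have D_ge0 : 0 <= 'D_1 l 0.
  rewrite -(cvg_lim _ q_right)//; apply: limr_ge; first by apply/cvg_ex; eexists; exact: q_right.
  near=> h; have h_gt0 : 0 < h by [].
  by rewrite mulr_ge0 ?invr_ge0 ?(ltW h_gt0)// subr_ge0.
have D_lt0 : 'D_1 l 0 <= - (1 - alpha).
  rewrite -(cvg_lim _ q_left)//; apply: limr_le; first by apply/cvg_ex; eexists; exact: q_left.
  near=> h; have h_lt0 : h < 0 by [].
  rewrite mulrC ler_ndivrMr// [l h]lE.
  by have := l_min (- h); nra.
lra.
Unshelve. all: by end_near. Qed.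

(* Main.v *)
(* Without signal noise, S0 = (z*/mu) e_1 gives every training sample the margin
   z*, so the minimizers of the training loss are the S whose N training margins
   all equal z*: an affine space directed by the kernel of an N x d design matrix
   with one column of labels and d - 1 Gaussian columns.
   If d <= N, the leading d x d minor is almost surely nonzero: expanding the
   last row, each leading minor is affine in its last entry, with the previous
   minor as slope, and that entry is independent of the others and has no atoms.
   So S0 is the only minimizer, and it classifies perfectly.
   If d > N, the kernel is nonzero, and minimizers S0 + t v with t large misread
   a fresh sample with positive probability. *)

Require Import Defs.
From mathcomp Require Import all_boot all_order all_algebra.
From mathcomp Require Import all_classical all_reals all_analysis.
From mathcomp Require Import measurable_realfun.
From mathcomp Require Import ring lra.

Import Order.TTheory GRing.Theory Num.Theory.
Import numFieldNormedType.Exports.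

Local Open Scope classical_set_scope.
Local Open Scope ring_scope.

(** * Independence of one variable from the sigma-algebra of the others *)

(** A pi-system generating the sigma-algebra of all variables but [Z i0]. The intersection runs over
    all of [I], with finite support [s], so that two cylinders intersect coordinatewise. *)
Definition cylinders_away {disp : measure_display} {T : measurableType disp}
    {R : realType} {P : probability T R} {I : choiceType}
    (Z : I -> {RV P >-> R}) (i0 : I) : set (set T) :=
  [set E | exists (s : seq I) (B : I -> set R),
    [/\ forall i, measurable (B i), forall i, i \notin s -> B i = setT,
        B i0 = setT & E = \bigcap_i (Z i @^-1` B i)]].

Lemma bigcap_finite_support {T U : Type} {I : eqType}
    (Z : I -> T -> U) (s : seq I) (B : I -> set U) :
  (forall i, i \notin s -> B i = setT) ->
  \bigcap_i (Z i @^-1` B i) = \bigcap_(i in [set` s]) (Z i @^-1` B i).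
Proof.
move=> BT; apply/seteqP; split=> w wB i; first by move=> _; exact: wB.
by move=> _; have [/wB//|/BT ->] := boolP (i \in s).
Qed.

Lemma cylinders_away_measurable {disp : measure_display}
    {T : measurableType disp} {R : realType} {P : probability T R}
    {I : choiceType} (Z : I -> {RV P >-> R}) (i0 : I) :
  cylinders_away Z i0 `<=` measurable.
Proof.
move=> _ [s [B [mB BT _ ->]]]; rewrite (bigcap_finite_support _ s)//.
apply: fin_bigcap_measurable; first exact: finite_seq.
by move=> i _; rewrite -[X in measurable X]setTI; exact: measurable_funP.
Qed.

Lemma cylinders_away_setI_closed {disp : measure_display}
    {T : measurableType disp} {R : realType} {P : probability T R}
    {I : choiceType} (Z : I -> {RV P >-> R}) (i0 : I) :
  setI_closed (cylinders_away Z i0).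
Proof.
move=> _ _ [s [B [mB BT B0 ->]]] [t [C [mC CT C0 ->]]].
exists (s ++ t), (fun i => B i `&` C i); split.
- by move=> i; exact: measurableI.
- by move=> i; rewrite mem_cat negb_or => /andP[/BT -> /CT ->]; rewrite setTI.
- by rewrite B0 C0 setTI.
- by rewrite -bigcapI; apply: eq_bigcapr => i _; rewrite preimage_setI.
Qed.

(** For fixed [A], both sides are finite measures in [E]. They agree on the pi-system of cylinders,
    hence on the sigma-algebra it generates. *)
Lemma independent_away {disp : measure_display} {T : measurableType disp}
    {R : realType} {P : probability T R} {I : choiceType}
    (Z : I -> {RV P >-> R}) (i0 : I) (A : set R) (E : set T) :
  mutually_independent Z -> measurable A ->
  <<s cylinders_away Z i0 >> E ->
  P (Z i0 @^-1` A `&` E) = (P (Z i0 @^-1` A) * P E)%E.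
Proof.
move=> indep mA.
have mZA i B : measurable B -> measurable (Z i @^-1` B).
  by move=> mB; rewrite -[X in measurable X]setTI; exact: measurable_funP.
have PA : P (Z i0 @^-1` A) = (fine (P (Z i0 @^-1` A)))%:E.
  by rewrite fineK// fin_num_measure//; exact: mZA.
have PA0 : 0 <= fine (P (Z i0 @^-1` A)) by exact: fine_ge0.
rewrite setIC [X in (X * _)%E]PA.
pose m1 : {measure set T -> \bar R} := mrestr P (mZA i0 A mA).
pose m2 : {measure set T -> \bar R} := mscale (NngNum PA0) P.
move=> sE; suff : m1 E = m2 E by [].
move: E sE; apply: (g_sigma_algebra_measure_unique _
  (cylinders_away_measurable Z i0) (fun=> setT)).
- by move=> _; exists [::], (fun=> setT); split=> //; rewrite bigcapT.
- by rewrite bigcup_const.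
- exact: cylinders_away_setI_closed.
- move=> _ [s [B [mB BT B0 ->]]].
  (* [mutually_independent] wants a duplicate-free list, here [i0 :: s']. The index [i0] may occur
     in [s], but only with a trivial constraint. *)
  pose s' := rem i0 (undup s).
  have us' : uniq s' by rewrite rem_uniq// undup_uniq.
  have i0s' : i0 \notin s' by rewrite mem_rem_uniq ?undup_uniq// inE eqxx.
  have BT' i : i \notin s' -> B i = setT.
    rewrite mem_rem_uniq ?undup_uniq// inE mem_undup negb_and negbK.
    by move=> /orP[/eqP ->|/BT].
  pose C i := if i == i0 then A else B i.
  have mC i : measurable (C i) by rewrite /C; case: ifP.
  have CB i : i \in s' -> C i = B i.
    by rewrite /C; case: eqP => // -> is'; rewrite is' in i0s'.
  rewrite /m1 /m2 /= /mrestr /mscale /= (bigcap_finite_support _ s')//.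
  have := indep (i0 :: s') C; rewrite /= i0s' us' => /(_ erefl mC).
  rewrite big_cons [C i0]/C eqxx EFinM => h.
  transitivity (P (\bigcap_(i in [set` i0 :: s']) (Z i @^-1` C i))).
    congr (P _); apply/seteqP; split=> w /=.
      move=> [wB wA] i /=; rewrite inE => /predU1P[->|is'].
        by rewrite /C eqxx.
      by rewrite CB//; exact: wB.
    move=> wC; split; last by have := wC i0; rewrite /= /C eqxx mem_head; exact.
    by move=> i /= is'; rewrite -CB//; apply: wC; rewrite /= inE is' orbT.
  rewrite h; congr (_ * _)%E; rewrite (indep s')//.
  by congr (_ %:E); apply: eq_big_seq => i /CB ->.
- move=> _; apply: le_lt_trans (ltry 1); apply: probability_le1.
  by rewrite setTI; apply: (mZA).
Qed.

Lemma measurable_away {disp : measure_display} {T : measurableType disp}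
    {R : realType} {P : probability T R} {I : choiceType}
    (Z : I -> {RV P >-> R}) (i0 i : I) : i != i0 ->
  measurable_fun setT
    (Z i : g_sigma_algebraType (cylinders_away Z i0) -> R).
Proof.
move=> ii0 _ B mB; rewrite setTI; apply: sub_sigma_algebra.
exists [:: i], (fun j => if j == i then B else setT); split.
- by move=> j; case: ifP.
- by move=> j; rewrite inE => /negbTE ->.
- by rewrite eq_sym (negbTE ii0).
- apply/seteqP; split=> w /=; first by move=> wB j _ /=; case: eqP => // ->.
  by move=> /(_ i Logic.I); rewrite /= eqxx.
Qed.

(* Conditionally on the other variables, [Z i0] would have to hit the single
   point - V / U. *)
Lemma affine_relation_null {disp : measure_display} {T : measurableType disp}
    {R : realType} {P : probability T R} {I : choiceType}
    (Z : I -> {RV P >-> R}) (i0 : I)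
    (U V : g_sigma_algebraType (cylinders_away Z i0) -> R) :
  mutually_independent Z -> (forall x, P (Z i0 @^-1` [set x]) = 0%E) ->
  measurable_fun setT U -> measurable_fun setT V ->
  P.-negligible [set w : T | U w != 0 /\ Z i0 w * U w + V w = 0].
Proof.
move=> indep atomless mU mV.
have sub E : <<s cylinders_away Z i0 >> E -> measurable E.
  apply: smallest_sub; first exact: sigma_algebra_measurable.
  exact: cylinders_away_measurable.
(* [UV'] keeps the measurability that independence requires; [UV] is the same map on the full
   sigma-algebra of [T], where it has a law under [P]. *)
pose UV' : g_sigma_algebraType (cylinders_away Z i0) -> R * R :=
  fun w => (U w, V w).
have mUV' : measurable_fun setT UV' by exact: measurable_fun_pair.
pose UV : T -> R * R := UV'.
have mUV : measurable_fun setT UV.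
  by move=> _ B mB; apply: sub; exact: mUV'.
have UVm : UV \in mfun by rewrite inE.
pose UVf : {mfun T >-> (R * R)%type} := mfun_Sub UVm.
pose h : T -> (R * R) * R := fun w => (UV w, Z i0 w).
have mh : measurable_fun setT h by exact: measurable_fun_pair.
have hm : h \in mfun by rewrite inE.
pose hf : {mfun T >-> ((R * R) * R)%type} := mfun_Sub hm.
pose D : set ((R * R) * R) := [set q | q.1.1 != 0 /\ q.2 * q.1.1 + q.1.2 = 0].
have m1 : measurable_fun setT (fun q : (R * R) * R => q.1.1).
  by apply: measurableT_comp => //; exact: measurable_fst.
have m2 : measurable_fun setT (fun q : (R * R) * R => q.1.2).
  by apply: measurableT_comp => //; exact: measurable_fst.
have m3 : measurable_fun setT (fun q : (R * R) * R => q.2 * q.1.1 + q.1.2).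
  by apply: measurable_funD => //; apply: measurable_funM.
have mD : measurable D.
  rewrite (_ : D = ((fun q : (R * R) * R => q.1.1) @^-1` (~` [set 0])) `&`
    ((fun q : (R * R) * R => q.2 * q.1.1 + q.1.2) @^-1` [set 0])).
    apply: measurableI; rewrite -[X in measurable X]setTI.
      by apply: m1 => //; apply: measurableC.
    by apply: m3.
  by apply/seteqP; split=> q /= [q0 e]; split=> //; apply/eqP.
exists (h @^-1` D); split => //.
  by rewrite -[X in measurable X]setTI; exact: mh.
have -> : P (h @^-1` D) = distribution P hf D by [].
(* By independence, checked on rectangles at the end, the joint law is a product. Fubini then leaves
   the sections of [D]: empty where U = 0, inside the point -V/U elsewhere. *)
rewrite -(@product_measure_unique _ _ _ _ _
  (distribution P UVf) (distribution P (Z i0)))//.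
  apply: integral0_eq => q _; rewrite /= /pushforward.
  have [q0|q0] := eqVneq q.1 0.
    rewrite (_ : xsection D q = set0) ?preimage_set0 ?measure0//.
    by apply/seteqP; split=> x //=; rewrite /xsection /= inE /D /= q0 eqxx => -[].
  apply/eqP; rewrite eq_le measure_ge0 andbT -[leRHS](atomless (- q.2 / q.1)).
  apply: le_measure; rewrite ?inE.
  - exact: measurable_xsection.
  - exact: measurable_set1.
  - move=> w /=; rewrite /xsection /= inE /D /= => -[_ /eqP].
    by rewrite addr_eq0 => /eqP <-; rewrite mulfK.
move=> A B mA mB; rewrite /distribution /pushforward.
rewrite muleC -(independent_away Z)//; last first.
  by rewrite -[X in <<s _>> X]setTI; exact: mUV'.
by congr (P _); apply/seteqP; split => w /= [].
Qed.

(** * Almost sure invertibility of the square design *)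

Lemma normal_prob_set1 {R : realType} (m s x : R) :
  normal_prob m s [set x] = 0%E.
Proof.
have /null_content_dominatesP := normal_prob_dominates m s; apply => //.
exact: lebesgue_measure_set1.
Qed.

Lemma measurable_det {disp : measure_display} {T : measurableType disp}
    {R : realType} (n : nat) (A : T -> 'M[R]_n) :
  (forall i j, measurable_fun setT (fun w => A w i j)) ->
  measurable_fun setT (fun w => \det (A w)).
Proof.
move=> mA; apply: measurable_sum => s; apply: measurable_funM => //.
by apply: measurable_prod.
Qed.

(** Sending column 0 to the labels instead of the signal noise makes the entries of the design
    distinct members of a single independent family. *)
Definition design_index (i j : nat) : (nat + nat * nat)%type :=
  if j == 0%N then inl i else inr (i, j).

Lemma design_index_neq (i j k l : nat) :
  (i != k) || (j != l) -> design_index i j != design_index k l.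
Proof.
apply: contraTneq; rewrite /design_index negb_or !negbK.
by case: (j =P 0%N) => [->|_]; case: (l =P 0%N) => [->|_] // [];
  do ?move=> ->; rewrite !eqxx.
Qed.

(* Column 0 of the design carries the labels: under the margin of sample i, the
   label of i multiplies the signal and, squaring to 1, drops off the noise. *)
Definition design {disp : measure_display} {T : measurableType disp}
    {R : realType} {P : probability T R} (Z : nat + nat * nat -> {RV P >-> R})
    (N d : nat) (w : T) : 'M[R]_(N, d) :=
  \matrix_(i, j) Z (design_index i j) w.

Lemma det_design_null {disp : measure_display} {T : measurableType disp}
    {R : realType} {P : probability T R} (Z : nat + nat * nat -> {RV P >-> R})
    (d : nat) :
  mutually_independent Z ->
  (forall w, Z (inl 0%N) w != 0) ->
  (forall i j x, (0 < j)%N -> P (Z (inr (i, j)) @^-1` [set x]) = 0%E) ->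
  P.-negligible [set w | \det (design Z d d w) = 0].
Proof.
move=> indep Z0 atomless; elim: d => [|[_|k IHk]].
- rewrite (_ : mkset _ = set0); first exact: negligible_set0.
  by apply/seteqP; split=> w //=; rewrite det_mx00 => /eqP; rewrite oner_eq0.
(* At size 1 the determinant is a label, so no Gaussian entry is needed to start the induction. *)
- rewrite (_ : mkset _ = set0); first exact: negligible_set0.
  apply/seteqP; split=> w //=; rewrite det_mx11 mxE /= => /eqP.
  exact/negP/Z0.
- set n := k.+1 in IHk *.
  (* [V] collects the last-row terms other than the corner one; neither their entries nor their
     cofactors involve the corner entry. *)
  pose V w := \sum_(j < n) design Z n.+1 n.+1 w ord_max (widen_ord (leqnSn n) j) *
    cofactor (design Z n.+1 n.+1 w) ord_max (widen_ord (leqnSn n) j).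
  pose U w := \det (design Z n n w).
  have detE w : \det (design Z n.+1 n.+1 w) = Z (design_index n n) w * U w + V w.
    rewrite (expand_det_row _ ord_max) big_ord_recr /= addrC; congr (_ * _ + _).
      by rewrite mxE.
    rewrite /cofactor /= -signr_odd addnn odd_double expr0 mul1r; congr (\det _).
    by apply/matrixP => i j; rewrite !mxE !lift_max.
  have null := @affine_relation_null _ _ _ _ _ Z (design_index n n) U V indep
    (fun x => atomless n n x isT).
  apply: negligibleS (negligibleU IHk (null _ _)).
  + move=> w /=; rewrite detE; have [U0|U0] := eqVneq (U w) 0; first by left.
    by right.
  + apply: measurable_det => i j; rewrite (_ : (fun w => _) = Z (design_index i j)).
      by apply: measurable_away; apply: design_index_neq; rewrite ltn_eqF.
    by apply/funext => w; rewrite mxE.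
  + apply: measurable_sum => j; apply: measurable_funM.
      rewrite (_ : (fun w => _) = Z (design_index n j)).
        apply: measurable_away; apply: design_index_neq.
        by rewrite (@ltn_eqF j) ?orbT.
      by apply/funext => w; rewrite mxE.
    apply: measurable_funM => //; apply: measurable_det => i l.
    set j' := widen_ord _ _.
    rewrite (_ : (fun w => _) = Z (design_index i (lift j' l))).
      by apply: measurable_away; apply: design_index_neq; rewrite ltn_eqF.
    by apply/funext => w; rewrite !mxE lift_max.
Qed.

(** * Null sets and the sign of the sample optimum *)

Lemma measurable_fiber {disp : measure_display} {T : measurableType disp}
    {R : realType} (X : {mfun T >-> R}) (x : R) : measurable [set w | X w = x].
Proof.
by rewrite -[X in measurable X]setTI; exact: measurable_funP (measurable_set1 x).
Qed.

Lemma negligible_setC {disp : measure_display} {T : measurableType disp}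
    {R : realType} {P : probability T R} (A : set T) :
  measurable A -> P A = 1%E -> P.-negligible (~` A).
Proof.
move=> mA PA; apply/negligibleP; first exact: measurableC.
by have := probability_setC P mA; rewrite PA subee.
Qed.

(** Between z* and -z* the even [f] cancels, leaving the decreasing logistic term: if z* were
    negative, -z* would do at least as well. *)
Lemma global_minimum_gt0 {R : realType} (alpha zstar : R) (f : R -> R) :
  alpha < 1 -> (forall z, f (- z) = f z) ->
  unique_global_minimum (sample_loss alpha f) zstar -> zstar != 0 ->
  0 < zstar.
Proof.
move=> alpha_lt1 f_even zmin z0; rewrite lt_neqAle eq_sym z0 leNgt /=.
apply/negP => zlt0; have zN : - zstar != zstar.
  by rewrite gt_eqF// (lt_trans zlt0)// oppr_gt0.
have := zmin _ zN; rewrite /sample_loss f_even opprK ltrD2r ltr_pM2l ?subr_gt0//.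
apply/negP; rewrite -leNgt ler_ln ?posrE ?addr_gt0 ?expR_gt0// lerD2l ler_expR.
by rewrite (le_trans (ltW zlt0))// oppr_ge0 ltW.
Qed.

(** * Margins as linear functions of the rescaled weights *)

(** Absorbs the signal strength into the first weight, so that margins without signal noise are read
    off a design matrix free of [mu]. *)
Definition rescale {R : realType} (mu : R) {d : nat} (S : 'cV[R]_d) : 'cV[R]_d :=
  \col_j ((if val j == 0%N then mu else 1) * S j 0).

Section margins.
Context {disp : measure_display} {T : measurableType disp} {R : realType}.
Context {P : probability T R}.
Variables (y : nat -> {RV P >-> R}) (xi : nat -> nat -> {RV P >-> R}) (mu : R).
Hypothesis y_sign : forall i w, y i w = 1 \/ y i w = -1.
Local Notation Z := (sample_variables y xi).

Lemma label_neq0 i w : y i w != 0.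
Proof. by have [->|->] := y_sign i w; rewrite ?oppr_eq0 oner_neq0. Qed.

Lemma marginE d (S : 'cV[R]_d) i w :
  margin y xi mu S i w =
  y i w * \sum_j S j 0 * (y i w * mu * (val j == 0%N)%:R + xi i (val j) w).
Proof.
by rewrite /margin mxE; congr (_ * _); apply: eq_bigr => j _; rewrite !mxE.
Qed.

Lemma margin_linear {d} (S S' : 'cV[R]_d) t i w :
  margin y xi mu (S + t *: S') i w =
  margin y xi mu S i w + t * margin y xi mu S' i w.
Proof.
rewrite !marginE mulrCA -mulrDr; congr (_ * _); rewrite mulr_sumr -big_split /=.
by apply: eq_bigr => j _; rewrite !mxE; ring.
Qed.

Lemma measurable_margin {d} (S : 'cV[R]_d) i :
  measurable_fun setT (margin y xi mu S i).
Proof.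
rewrite (funext (marginE _ S i)); apply: measurable_funM => //.
apply: measurable_sum => j; apply: measurable_funM => //.
apply: measurable_funD => //; apply: measurable_funM => //.
exact: measurable_funM.
Qed.

Lemma measurable_accurate {d} (S : 'cV[R]_d) i :
  measurable [set w | 0 < margin y xi mu S i w].
Proof.
rewrite (_ : mkset _ = margin y xi mu S i @^-1` `]0, +oo[).
  by rewrite -[X in measurable X]setTI; exact: measurable_margin.
by apply/seteqP; split=> w; rewrite /= in_itv /= andbT.
Qed.

Lemma margin_design {d} (S : 'cV[R]_d) N (i : 'I_N) w : xi i 0%N w = 0 ->
  margin y xi mu S i w = y i w * (design Z N d w *m rescale mu S) i 0.
Proof.
move=> xi0; rewrite marginE; congr (_ * _); rewrite mxE.
apply: eq_bigr => j _; rewrite !mxE /design_index.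
case: eqP => [->|_]; rewrite /= ?xi0; ring.
Qed.

Lemma margin_e1 d i w : (0 < d)%N ->
  margin y xi mu (e1 R d) i w = mu + y i w * xi i 0%N w.
Proof.
move=> d_gt0; rewrite marginE (bigD1 (Ordinal d_gt0)) //= big1.
  rewrite mxE /= mul1r mulr1 addr0 mulrDr mulrA.
  by have [->|->] := y_sign i w; rewrite ?mulrNN ?mulr1 mul1r.
by move=> j j0; rewrite mxE -[val j == 0%N]/(j == Ordinal d_gt0) (negbTE j0) mul0r.
Qed.

Lemma rescale_inj {d} (S : 'cV[R]_d) : mu != 0 -> rescale mu S = 0 -> S = 0.
Proof.
move=> mu0 /colP S0; apply/colP => j; have /eqP := S0 j.
by rewrite !mxE mulf_eq0; case: ifP => _; rewrite ?oner_eq0 ?(negbTE mu0) => /eqP.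
Qed.

Lemma rescale_surj {d} (u : 'cV[R]_d) : mu != 0 -> exists S, rescale mu S = u.
Proof.
move=> mu0; exists (\col_j ((if val j == 0%N then mu else 1)^-1 * u j 0)).
apply/colP => j; rewrite !mxE mulVKf//.
by case: ifP => _; rewrite ?oner_eq0.
Qed.

End margins.

(** * Minimizers for a fixed training outcome and fixed sizes *)

Section minimizers.
Context {disp : measure_display} {T : measurableType disp} {R : realType}.
Context {P : probability T R}.
Variables (y : nat -> {RV P >-> R}) (xi : nat -> nat -> {RV P >-> R}).
Variables (mu alpha zstar : R) (f : R -> R).
Hypothesis y_sign : forall i w, y i w = 1 \/ y i w = -1.
Hypothesis mu_gt0 : 0 < mu.
Hypothesis zstar_min : unique_global_minimum (sample_loss alpha f) zstar.
Hypothesis zstar_gt0 : 0 < zstar.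
Variables (d N : nat) (w : T).
Hypothesis d_gt0 : (0 < d)%N.
Hypothesis N_gt0 : (0 < N)%N.
Hypothesis no_signal_noise : forall i, (i < N)%N -> xi i 0%N w = 0.

Local Notation Z := (sample_variables y xi).
Let S0 : 'cV[R]_d := (zstar / mu) *: e1 R d.

Lemma margin_aligned i v :
  margin y xi mu S0 i v = zstar + zstar / mu * (y i v * xi i 0%N v).
Proof.
have := @margin_linear _ _ _ _ y xi mu d 0 (e1 R d) (zstar / mu) i v.
rewrite add0r => ->; rewrite margin_e1// /margin linear0 mul0mx mxE mulr0 add0r.
by rewrite mulrDr divfK// gt_eqF.
Qed.

(** [S0] reaches the termwise lower bound on all samples at once. A minimizer missing it on a single
    sample would therefore have a strictly larger sum than [S0]. *)
Lemma training_minimizerP (S : 'cV[R]_d) :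
  training_minimizer y xi alpha mu f N w S <->
  forall i : 'I_N, margin y xi mu S i w = zstar.
Proof.
set l := sample_loss alpha f.
have lmin z : l zstar <= l z.
  by have [->//|/zstar_min/ltW] := eqVneq z zstar.
have lossE (S' : 'cV[R]_d) : (forall i : 'I_N, margin y xi mu S' i w = zstar) ->
    training_loss y xi alpha mu f N w S' = N%:R^-1 * \sum_(i < N) l zstar.
  by move=> S'z; congr (_ * _); apply: eq_bigr => i _; rewrite S'z.
split=> [Smin i|Sz S']; last first.
  by rewrite lossE// ler_wpM2l ?invr_ge0// ler_sum.
apply/eqP/negP => /negP /zstar_min lt_i.
have := Smin S0; rewrite (lossE S0); last first.
  by move=> j; rewrite margin_aligned no_signal_noise ?mulr0 ?addr0.
rewrite ler_pM2l ?invr_gt0 ?ltr0n// leNgt => /negP; apply.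
rewrite (bigD1 i)//= [ltRHS](bigD1 i)//= ltr_leD// ler_sum//.
Qed.

Lemma accuracy_aligned :
  P [set v | xi N 0%N v = 0] = 1%E -> accuracy y xi mu N S0 = 1%E.
Proof.
move=> xi0; apply/eqP; rewrite eq_le probability_le1 /=; last first.
  exact: measurable_accurate.
rewrite -xi0; apply: le_measure; rewrite ?inE.
- exact: measurable_fiber.
- exact: measurable_accurate.
- by move=> v /= xiv; rewrite margin_aligned xiv !mulr0 addr0.
Qed.

(** The rescaled difference of two minimizers lies in the kernel of the design, and the first [d]
    rows alone already make that kernel trivial. *)
Lemma perfect_minimizer_of_det :
  P [set v | xi N 0%N v = 0] = 1%E -> (d <= N)%N ->
  \det (design Z d d w) != 0 ->
  perfect_minimizer y xi alpha mu f d N w.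
Proof.
move=> xi0 dN det0.
have S0min : training_minimizer y xi alpha mu f N w S0.
  apply/training_minimizerP => i.
  by rewrite margin_aligned no_signal_noise// !mulr0 addr0.
split; first by exists S0.
move=> S /training_minimizerP Smin.
suff -> : S = S0 by exact: accuracy_aligned.
apply/eqP; rewrite -subr_eq0; apply/eqP/(rescale_inj mu); first by rewrite gt_eqF.
have u0 (i : 'I_N) : (design Z N d w *m rescale mu (S - S0)) i 0 = 0.
  have xii := no_signal_noise _ (ltn_ord i).
  have := margin_linear y xi mu S0 (S - S0) 1 i w.
  rewrite scale1r subrKC Smin margin_aligned xii !mulr0 addr0 mul1r.
  move=> /eqP; rewrite -[X in X == _]addr0 (inj_eq (addrI _)) eq_sym.
  rewrite margin_design// mulf_eq0.
  by rewrite (negbTE (label_neq0 _ y_sign _ _)) => /eqP.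
have detU : design Z d d w \in unitmx by rewrite unitmxE unitfE.
(* The square design consists of the first [d] rows of the [N]-row one, so it kills the same
   vector. *)
rewrite -[LHS](mulKmx detU) (_ : _ *m rescale _ _ = 0) ?mulmx0//.
apply/colP => i; rewrite [RHS]mxE -[RHS](u0 (widen_ord dN i)) !mxE.
by apply: eq_bigr => j _; rewrite !mxE.
Qed.

(* A nonzero v with vanishing training margins yields the minimizers S0 + t v
   for all t. If all were perfectly accurate, the margin of a fresh sample at v
   would vanish almost surely, although it depends on some Gaussian noise. *)
Lemma not_perfect_minimizer :
  P [set v | xi N 0%N v = 0] = 1%E -> (N < d)%N ->
  mutually_independent Z ->
  (forall i j x, (0 < j)%N -> P (xi i j @^-1` [set x]) = 0%E) ->
  ~ perfect_minimizer y xi alpha mu f d N w.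
Proof.
move=> xi0 Nd indep atomless [_ perfect].
pose A := design Z N d w.
have [u u0 Au0] : exists2 u : 'cV[R]_d, u != 0 & A *m u = 0.
  have kerA : kermx A^T != 0.
    by rewrite kermx_eq0 neq_ltn (leq_ltn_trans (rank_leq_col _)).
  exists (nz_row (kermx A^T))^T; first by rewrite trmx_eq0 nz_row_eq0.
  have /sub_kermxP := nz_row_sub (kermx A^T).
  by move=> /(congr1 trmx); rewrite trmx_mul trmxK trmx0.
(* A kernel vector supported on coordinate 0 would give [A *m u] a first entry equal to a label
   times that coordinate, hence would be zero. *)
have [j j_gt0 uj0] : exists2 j : 'I_d, (0 < j)%N & u j 0 != 0.
  apply/exists2P/not_existsP => uj; move/eqP: u0; apply.
  have uj0 (j : 'I_d) : (0 < j)%N -> u j 0 = 0.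
    by move=> j0; apply/eqP/negP => /negP uj0; apply: (uj j).
  apply/colP => j; rewrite mxE; have [j0|/uj0//] := posnP j.
  have := congr1 (fun B : 'cV_N => B (Ordinal N_gt0) 0) Au0.
  rewrite /= mxE (bigD1 j)//= big1 => [|k kj]; last first.
    rewrite uj0 ?mulr0// lt0n; apply: contra kj => /eqP k0.
    by apply/eqP/val_inj; rewrite /= k0 j0.
  rewrite addr0 !mxE j0 /= => /eqP; rewrite mulf_eq0.
  by rewrite (negbTE (label_neq0 _ y_sign _ _)) => /eqP.
have [v vu] := rescale_surj mu u (lt0r_neq0 mu_gt0).
have Smin t : training_minimizer y xi alpha mu f N w (S0 + t *: v).
  apply/training_minimizerP => i; have xii := no_signal_noise _ (ltn_ord i).
  rewrite margin_linear margin_aligned xii margin_design// vu Au0.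
  by rewrite mxE !mulr0 !addr0.
pose m := margin y xi mu v N.
have null_mt t : P.-negligible [set x | margin y xi mu (S0 + t *: v) N x <= 0].
  rewrite (_ : mkset _ = ~` [set x | 0 < margin y xi mu (S0 + t *: v) N x]).
    by apply: negligible_setC; [exact: measurable_accurate|exact: perfect].
  by apply/seteqP; split=> x /=; rewrite leNgt => /negP.
have null_xi : P.-negligible [set x | xi N 0%N x != 0].
  rewrite (_ : mkset _ = ~` [set x | xi N 0%N x = 0]).
    by apply: negligible_setC => //; exact: measurable_fiber.
  by apply/seteqP; split=> x /= /eqP.
have null_m0 : P.-negligible [set x | xi N 0%N x = 0 /\ m x = 0].
  pose k := design_index N j.
  have kE : k = inr (N, val j) by rewrite /k /design_index gtn_eqF.
  have null := @affine_relation_null _ _ _ _ _ Z k (cst (u j 0))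
    (fun x => \sum_(l | l != j) Z (design_index N l) x * u l 0) indep.
  apply: negligibleS (null _ _ _).
  (* The fresh sample is the last row of a design with [N.+1] rows. Its margin at [v] is, up to a
     sign, affine in the noise at coordinate [j], with the nonzero constant slope [u j 0]. *)
  - move=> x [xiN /eqP]; rewrite /m (@margin_design _ _ _ _ _ _ _ _ _ N.+1 ord_max)//.
    rewrite mulf_eq0 (negbTE (label_neq0 _ y_sign _ _)) vu /= mxE (bigD1 j)//=.
    move=> /eqP e; split => //; rewrite -[RHS]e mxE; congr (_ + _).
    by apply: eq_bigr => l _; rewrite mxE.
  - by rewrite kE => x; exact: atomless.
  - exact: measurable_cst.
  - rewrite (_ : (fun x => _) = fun x => \sum_l
        if l != j then Z (design_index N l) x * u l 0 else 0); last first.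
      by apply: funext => x; exact: big_mkcond.
    apply: measurable_sum => l; have [lj|_] := boolP (l != j); last first.
      exact: measurable_cst.
    apply: measurable_funM; last exact: measurable_cst.
    by apply: measurable_away; apply: design_index_neq; rewrite lj orbT.
(* Integer multiples of [v], of both signs, suffice and keep the union of null sets countable. *)
have null_m : P.-negligible (\bigcup_n (
    [set x | margin y xi mu (S0 + n%:R *: v) N x <= 0] `|`
    [set x | margin y xi mu (S0 + (- n%:R) *: v) N x <= 0])).
  by apply: negligible_bigcup => n; exact: negligibleU.
have : P.-negligible setT.
  apply: negligibleS (negligibleU null_xi (negligibleU null_m0 null_m)).
  move=> x _; have [xiN|xiN] := eqVneq (xi N 0%N x) 0; last by left.
  right; have [mx|mx] := eqVneq (m x) 0; first by left.
  (* This [n] is large enough for the shift by [n * m x], taken with the sign opposite to that of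
     [m x], to outweigh the margin z* of [S0]. *)
  right; pose n := (Num.trunc (zstar / `|m x|)).+1.
  have zn : zstar < n%:R * `|m x|.
    by rewrite -ltr_pdivrMr ?normr_gt0// truncnS_gt.
  exists n => //=; rewrite !margin_linear margin_aligned xiN !mulr0 addr0.
  rewrite -/(m x); have [mx0|mx0] := leP 0 (m x).
    by right; rewrite (ger0_norm mx0) in zn; lra.
  by left; rewrite (ltr0_norm mx0) in zn; lra.
move=> /(negligibleP _ measurableT) PT0.
by have /eqP := @probability_setT _ _ _ P; rewrite [P _]PT0 eq_sym onee_eq0.
Qed.

End minimizers.

(** * Sizes in the proportional limit *)

(** Covers the critical ratio 1 as well, where the limit alone does not exclude [d] exceeding [N] at
    every stage. *)
Lemma ratio_above {R : realType} (lambda : R) : 1 <= lambda ->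
  exists d N : nat -> nat,
    proportional_limit lambda d N /\ (forall n, 0 < N n < d n)%N.
Proof.
(* Rounding strictly up gives d > N even when [lambda] is 1, while the ratio exceeds [lambda] by at
   most 1/N. *)
move=> lambda_ge1; pose d n := (Num.trunc (lambda * n.+1%:R)).+1.
have d_gt n : lambda * n.+1%:R < (d n)%:R by exact: truncnS_gt.
have d_le n : (d n)%:R <= lambda * n.+1%:R + 1.
  rewrite /d -natr1 lerD2r; have /truncn_itv/andP[]// : 0 <= lambda * n.+1%:R.
  by rewrite mulr_ge0// (le_trans ler01).
have dn n : (n.+1 < d n)%N.
  by rewrite -(ltr_nat R) (le_lt_trans _ (d_gt n))// ler_peMl.
exists d, succn; split=> //; split.
- apply/cvgnyPge => A; near=> n; rewrite (leq_trans _ (ltnW (dn n)))// leqW//.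
  by near: n; exact: nbhs_infty_ge.
- rewrite (_ : succn = addn^~ 1%N); first exact: cvg_addnr.
  by apply/funext => n; rewrite addn1.
- have cvg_hi : (lambda + n.+1%:R^-1) @[n --> \oo] --> lambda.
    rewrite -[X in _ --> X]addr0; apply: cvgD; first exact: cvg_cst.
    exact: cvg_harmonic.
  apply: (squeeze_cvgr _ (@cvg_cst _ lambda _ _ _) cvg_hi); near=> n.
  rewrite ler_pdivlMr ?ltr0n// (ltW (d_gt n)) /= ler_pdivrMr ?ltr0n//.
  by rewrite mulrDl mulVf ?pnatr_eq0// d_le.
Unshelve. all: by end_near.
Qed.

Lemma proportional_limit_lt1 {R : realType} (lambda : R) (d N : nat -> nat) :
  lambda < 1 -> proportional_limit lambda d N ->
  \forall n \near \oo, [&& 0 < d n, 0 < N n & d n <= N n]%N.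
Proof.
move=> lambda_lt1 [d_oo N_oo ratio].
have d_gt0 : \forall n \near \oo, (0 < d n)%N by exact: d_oo _ (nbhs_infty_gt 0).
have N_gt0 : \forall n \near \oo, (0 < N n)%N by exact: N_oo _ (nbhs_infty_gt 0).
have ratio_lt1 := cvgr_lt _ ratio _ lambda_lt1.
near=> n; have Nn : (0 < N n)%N by near: n.
rewrite Nn; apply/and3P; split=> //; first by near: n.
rewrite -(ler_nat R) -[leRHS]mul1r -ler_pdivrMr ?ltr0n// ltW//.
by near: n; exact: ratio_lt1.
Unshelve. all: by end_near.
Qed.

Lemma proportional_limit_gt1 {R : realType} (lambda : R) (d N : nat -> nat) :
  1 < lambda -> proportional_limit lambda d N ->
  \forall n \near \oo, (0 < N n < d n)%N.
Proof.
move=> lambda_gt1 [_ N_oo ratio].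
have N_gt0 : \forall n \near \oo, (0 < N n)%N by exact: N_oo _ (nbhs_infty_gt 0).
have ratio_gt1 := cvgr_gt _ ratio _ lambda_gt1.
near=> n; have Nn : (0 < N n)%N by near: n.
rewrite Nn -(ltr_nat R) -[ltLHS]mul1r -ltr_pdivlMr ?ltr0n//.
by near: n; exact: ratio_gt1.
Unshelve. all: by end_near.
Qed.

(** At ratio 1 the limit is compatible with both d <= N and d > N. The first equivalence therefore
    quantifies over all size sequences; away from 1, the second one settles each sequence
    separately. *)
Theorem proposition5p1 (R : realType)
  (disp : measure_display) (T : measurableType disp) (P : probability T R)
  (y : nat -> {RV P >-> R}) (xi : nat -> nat -> {RV P >-> R})
  (mu_f sigma_f sigma_n alpha zstar : R) (f : R -> R)
  (mu_f_gt0 : 0 < mu_f) (sigma_f_eq0 : sigma_f = 0) (sigma_n_gt0 : 0 < sigma_n)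
  (model : signal_plus_noise y xi sigma_f sigma_n)
  (alpha_gt0 : 0 < alpha) (alpha_lt1 : alpha < 1)
  (f_convex : convex_function [set: R^o] f)
  (f_even : forall z, f (- z) = f z)
  (zstar_min : unique_global_minimum (sample_loss alpha f) zstar)
  (zstar_neq0 : zstar != 0)
  (lambda : R) (lambda_gt0 : 0 < lambda) :
  ((forall d N : nat -> nat, proportional_limit lambda d N ->
      with_high_probability P
        (fun n => [set w | perfect_minimizer y xi alpha mu_f f (d n) (N n) w]))
    <-> lambda < 1)
  /\
  (lambda != 1 ->
   forall d N : nat -> nat, proportional_limit lambda d N ->
     (with_high_probability P
        (fun n => [set w | perfect_minimizer y xi alpha mu_f f (d n) (N n) w])
      <-> lambda < 1)).
Proof.
have [y_sign signal_law noise_law indep] := model.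
have zstar_gt0 := global_minimum_gt0 _ _ _ alpha_lt1 f_even zstar_min zstar_neq0.
have xi0 i : P [set w | xi i 0%N w = 0] = 1%E.
  have := signal_law i [set 0] (measurable_set1 _).
  by rewrite /centered_gaussian sigma_f_eq0 eqxx diracE mem_set.
have atomless i j x : (0 < j)%N -> P (xi i j @^-1` [set x]) = 0%E.
  move=> j_gt0; have := noise_law i j [set x] j_gt0 (measurable_set1 _).
  by rewrite /centered_gaussian gt_eqF// normal_prob_set1.
(* A zero variance removes the signal noise only almost surely, so the exceptional outcomes of the
   training samples are gathered in one null set. *)
have null_noise N : P.-negligible (\bigcup_(i < N) [set w | xi i 0%N w != 0]).
  rewrite bigcup_mkcond; apply: negligible_bigcup => i; case: ifP => _.
    rewrite (_ : mkset _ = ~` [set w | xi i 0%N w = 0]).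
      by apply: negligible_setC => //; exact: measurable_fiber.
    by apply/seteqP; split=> w /= /eqP.
  exact: negligible_set0.
have success d N : lambda < 1 -> proportional_limit lambda d N ->
    with_high_probability P
      (fun n => [set w | perfect_minimizer y xi alpha mu_f f (d n) (N n) w]).
  move=> lambda_lt1 /(proportional_limit_lt1 _ _ _ lambda_lt1) dN.
  have null n : P.-negligible ([set w | \det (design (sample_variables y xi)
      (d n) (d n) w) = 0] `|` \bigcup_(i < N n) [set w | xi i 0%N w != 0]).
    apply: negligibleU => //; apply: det_design_null => //.
    exact: label_neq0.
  have [B BP] := choice null.
  (* [B n] is a measurable null set covering the bad outcomes. The empty set is taken only at sizes
     that do not occur for large [n]. *)
  exists (fun n => if [&& 0 < d n, 0 < N n & d n <= N n]%N then ~` B n else set0).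
  split.
  - move=> n; case: ifP => // _; apply: measurableC.
    by have [] := BP n.
  - move=> n; case: ifP => [/and3P[dn Nn dNn] w /= Bw|_ w []].
    have [_ _ sub] := BP n.
    apply: (perfect_minimizer_of_det _ _ _ _ zstar) => //.
    + move=> i iN; apply/eqP/negP => /negP xi_neq0; apply/Bw/sub; right.
      by exists i.
    + by apply/eqP => det0; apply/Bw/sub; left.
  - apply: cvg_near_cst; near=> n.
    have -> : [&& 0 < d n, 0 < N n & d n <= N n]%N by near: n.
    have [mB B0 _] := BP n.
    by have := probability_setC P mB; rewrite B0 sube0.
(* Assuming d > N eventually, rather than a bound on [lambda], serves both ratios above 1 and the
   sequence of [ratio_above]. *)
have failure d N : (\forall n \near \oo, (0 < N n < d n)%N) ->
    ~ with_high_probability P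
      (fun n => [set w | perfect_minimizer y xi alpha mu_f f (d n) (N n) w]).
  move=> Nd [A [mA Aperfect PA]].
  (* For large [n], success is possible only where some training signal noise is nonzero, so every
     event inside it is null. *)
  have PA0 : P (A n) @[n --> \oo] --> 0%E.
    apply: cvg_near_cst; near=> n.
    have /andP[Nn Ndn] : (0 < N n < d n)%N by near: n.
    apply/(negligibleP _ (mA n)); apply: negligibleS (null_noise (N n)) => w Aw.
    apply: contrapT => no_noise.
    apply: (not_perfect_minimizer y xi mu_f alpha zstar f y_sign mu_f_gt0
      zstar_min (d n) (N n) w) (Aperfect n w Aw) => //.
      exact: leq_ltn_trans Ndn.
    by move=> i iN; apply/eqP/negP => /negP xi_neq0; apply: no_noise; exists i.
  have e : 1%E = 0%E :> \bar R := cvg_unique (@ereal_hausdorff R) PA PA0.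
  by have := @onee_neq0 R; rewrite e eqxx.
split; last first.
  move=> lambda_neq1 d N dN; split; last by move=> lt1; exact: success.
  move=> whp; rewrite ltNge le_eqVlt eq_sym (negbTE lambda_neq1) /=.
  by apply/negP => /proportional_limit_gt1/(_ dN)/failure/(_ whp).
split; last by move=> lt1 d N; exact: success.
move=> whp; rewrite ltNge; apply/negP => /ratio_above[d [N [dN Nd]]].
by apply: (failure d N) (whp d N dN); near=> n; exact: Nd.
Unshelve. all: by end_near.
Qed.
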